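(* Let $\varepsilon_1, \varepsilon_2, \dots$ be independent Rademacher random variables. For every $n \geq 1$ and every real $p \geq 1$, the function $$\Phi(t_1, \dots, t_n) = \log\mathbb{E}\left|e^{t_1}\varepsilon_1 + \dots + e^{t_n}\varepsilon_n\right|^p$$ is convex on $\mathbb{R}^n$.
   Context: A Rademacher random variable $\varepsilon$ is a random sign: $\mathbb{P}(\varepsilon = 1) = \mathbb{P}(\varepsilon = -1) = \frac12$. *)

(* Defs.v *)
From HB Require Import structures.
From mathcomp Require Import all_boot all_order all_algebra.
From mathcomp Require Import finmap.
From mathcomp Require Import all_classical all_reals all_analysis.

Set Implicit Arguments.
Unset Strict Implicit.
Unset Printing Implicit Defensive.

Import Order.TTheory GRing.Theory Num.Theory.

Local Open Scope classical_set_scope.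
Local Open Scope ring_scope.

Definition rademacher (R : realType) (d : measure_display)
    (T : measurableType d) (P : probability T R) (X : {RV P >-> R}) : Prop :=
  distribution P X [set 1] = (2^-1)%:E /\
  distribution P X [set -1] = (2^-1)%:E.

(* Mutual (not merely pairwise) independence of a possibly infinite family:
   the product rule for every finite subfamily. *)
Definition independent_RVs (R : realType) (d : measure_display)
    (T : measurableType d) (P : probability T R) (I : choiceType)
    (X : I -> {RV P >-> R}) : Prop :=
  forall (J : {fset I}) (A : I -> set R), (forall i, measurable (A i)) ->
    P (\bigcap_(i in [set` J]) (X i @^-1` A i)) =
    (\prod_(i <- J) P (X i @^-1` A i))%E.

(* [fine] and [ln] only meet their default values at an infinite or null
   expectation. For Rademacher [eps], [p >= 1] and [n >= 1] there is neither:
   the sum is a.s. bounded and is nonzero with positive probability. *)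
Definition Phi (R : realType) (d : measure_display) (T : measurableType d)
    (P : probability T R) (eps : nat -> {RV P >-> R}) (n : nat) (p : R)
    (t : 'rV[R]_n) : R :=
  ln (fine 'E_P[(fun w =>
    `|\sum_(i < n) expR (t ord0 i) * eps i w| `^ p)%R]%E).

(* Main.v *)
Require Import Defs.
From HB Require Import structures.
From mathcomp Require Import all_boot all_order all_algebra.
From mathcomp Require Import finmap.
From mathcomp Require Import all_classical all_reals all_analysis.
From mathcomp Require Import measurable_realfun.
From mathcomp Require Import ring lra.

Import Order.TTheory GRing.Theory Num.Theory.

Local Open Scope classical_set_scope.
Local Open Scope ring_scope.

(** Put [x_i = e^(t_i)] and [X = \sum_i x_i eps_i].  The proof exhibits, at every
    point [u], an affine minorant of [Phi] that touches it at [u]; a function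
    with this property is convex ([convex_function_of_tangents]).

    By duality, the [L^p] norm of [X] is the largest value of [E(X Y)] over [Y] in
    the unit ball of [L^q], where [q] is the exponent conjugate to [p].  It is
    attained when [Y] is proportional to [phi(X)], with
    [phi(y) = sgn(y) |y|^(p-1)].  For a fixed [Y], the number
    [E(X Y) = \sum_i x_i E(eps_i Y)] is linear in [x].  Since [phi] is
    nondecreasing and [x_i >= 0], turning [eps_i] from -1 to 1 can only increase
    [phi(X)], so the coefficients [c_i = E(eps_i phi(X))] are nonnegative
    ([sign_correlation_ge0]).  Hence [ln] of the [L^p] norm is a supremum of
    functions [ln (\sum_i c_i e^(t_i))] with [c_i >= 0], and each of those is
    convex.

    The minorant at [u] comes from using both facts, the duality and the convexity
    of the exponential sums, in tangent form.  Let [x_i = e^(u_i)], write [F(x)]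
    for the sum of [|X|^p] over all sign vectors, and put
    [w_i = x_i c_i / F(x)], with [c_i] now a sum over sign vectors; these weights
    add up to 1.  Convexity of [exp] gives [\sum_i c_i e^(t_i) >= e^m F(x)] with
    [m = \sum_i w_i (t_i - u_i)] ([weighted_expR_ge]), and Young's inequality
    turns this lower bound on a correlation into
    [F(e^t) >= e^(p m) F(x)] ([moment_ge_of_correlation]).  Taking logarithms, the
    gradient at [u] is [p w].

    All this happens on the finite cube of sign vectors; by independence the
    expectation in [Phi] is the uniform average over that cube
    ([expectation_sign_average]). *)

(** * Signed powers and convexity inequalities *)

(** Up to normalisation, the dual vector at which Hoelder's inequality for the
    exponent [r + 1] is an equality. *)
Definition signed_powR {R : realType} (r y : R) : R := Num.sg y * `|y| `^ r.

Lemma signed_powR_nondecreasing {R : realType} {r : R} : 0 <= r ->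
  {homo signed_powR r : x y / x <= y}.
Proof.
move=> r0 x y xy; rewrite /signed_powR.
have [x0|x0|x0] := ltrgt0P x; have [y0|y0|y0] := ltrgt0P y;
  rewrite ?x0 ?y0 ?sgr0 ?mul0r //; try by exfalso; lra.
- by rewrite !gtr0_sg// !mul1r ge0_ler_powR// nnegrE ltW.
- rewrite (ltr0_sg x0) (gtr0_sg y0) mulN1r mul1r.
  by apply: le_trans (powR_ge0 _ _); rewrite oppr_le0 powR_ge0.
- by rewrite !ltr0_sg// !mulN1r lerN2 ge0_ler_powR ?nnegrE ?lerN2
    ?oppr_ge0 // ltW.
- by rewrite ltr0_sg// mulN1r oppr_le0 powR_ge0.
- by rewrite gtr0_sg// mul1r powR_ge0.
Qed.

Lemma mulr_signed_powR {R : realType} {p : R} (y : R) : 0 < p ->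
  y * signed_powR (p - 1) y = `|y| `^ p.
Proof.
by move=> p0; rewrite /signed_powR mulrA [y * _]mulrC -normrEsg mulr_powRB1.
Qed.

(** Young's inequality between [a] and [b^(p-1)]; equivalently, the convex
    function [a^p] lies above its tangent line at [b]. *)
Lemma powR_tangent {R : realType} {p a b : R} : 1 <= p -> 0 <= a -> 0 <= b ->
  p * (a * b `^ (p - 1)) - (p - 1) * b `^ p <= a `^ p.
Proof.
rewrite le_eqVlt => /predU1P[<-|p1] a0 b0.
  by rewrite subrr powRr0 mulr1 mul0r subr0 mul1r powRr1.
have p0 : 0 < p by lra.
have p10 : 0 < p - 1 by lra.
have q0 : 0 < p / (p - 1) by rewrite divr_gt0.
have pq : p^-1 + (p / (p - 1))^-1 = 1 by field; lra.
have := conjugate_powR a0 (powR_ge0 b (p - 1)) p0 q0 pq.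
rewrite -powRrM (_ : (p - 1) * (p / (p - 1)) = p); last by field; lra.
rewrite -(ler_pM2l p0) (_ : p * (_ + _) = a `^ p + (p - 1) * b `^ p) ?lerBlDr//.
by field; lra.
Qed.

(** Hoelder's inequality for a pairing with the dual vector of [X], in a form
    without roots: the pairing of [A] with that vector is at least [r] times
    the pairing of [X] with it only if the [L^p] norm of [A] is at least [r] times
    that of [X].  Summing the tangent inequality at [r |X s|] suffices. *)
Lemma moment_ge_of_correlation {R : realType} {I : finType} {p r : R}
    {A X : I -> R} : 1 <= p -> 0 <= r ->
  r * (\sum_s `|X s| `^ p) <= \sum_s A s * signed_powR (p - 1) (X s) ->
  r `^ p * (\sum_s `|X s| `^ p) <= \sum_s `|A s| `^ p.
Proof.
move=> p1 r0 h.
have p0 : 0 < p by lra.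
have sA s : A s * signed_powR (p - 1) (X s) <= `|A s| * `|X s| `^ (p - 1).
  rewrite (le_trans (ler_norm _))// normrM ler_wpM2l//.
  rewrite normrM normr_sg (ger0_norm (powR_ge0 _ _)).
  by case: eqVneq => _; rewrite ?mul0r ?mul1r ?powR_ge0.
have tg s : p * r `^ (p - 1) * (A s * signed_powR (p - 1) (X s))
    - (p - 1) * r `^ p * `|X s| `^ p <= `|A s| `^ p.
  apply: le_trans (powR_tangent p1 (normr_ge0 (A s))
    (mulr_ge0 r0 (normr_ge0 (X s)))).
  rewrite !powRM// [(p - 1) * (_ * _)]mulrA lerD2r -!mulrA (ler_wpM2l (ltW p0))//.
  by rewrite [leRHS]mulrCA ler_wpM2l ?powR_ge0.
apply: le_trans; last by apply: ler_sum => s _; exact: tg.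
rewrite sumrB -!mulr_sumr.
have -> : r `^ p * (\sum_s `|X s| `^ p) =
    p * r `^ (p - 1) * (r * \sum_s `|X s| `^ p)
    - (p - 1) * r `^ p * \sum_s `|X s| `^ p.
  by rewrite -(mulr_powRB1 r0 p0); ring.
by rewrite lerD2r ler_wpM2l// mulr_ge0 ?powR_ge0 ?ltW.
Qed.

(** Jensen's inequality for [exp], from its tangent at the weighted mean. *)
Lemma weighted_expR_ge {R : realType} {I : finType} {w : I -> R} (d : I -> R) :
  (forall i, 0 <= w i) -> \sum_i w i = 1 ->
  expR (\sum_i w i * d i) <= \sum_i w i * expR (d i).
Proof.
move=> w0 w1; set m := \sum_i w i * d i.
have tg i : w i * (expR m * (1 + (d i - m))) <= w i * expR (d i).
  rewrite ler_wpM2l// -[in leRHS](subrKC m (d i)) expRD.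
  by rewrite ler_wpM2l ?expR_ge0 ?expR_ge1Dx.
apply: le_trans; last by apply: ler_sum => i _; exact: tg.
rewrite (eq_bigr (fun i => expR m * (1 - m) * w i + expR m * (w i * d i))).
  by rewrite big_split/= -!mulr_sumr w1 -/m mulr1 -mulrDr subrK mulr1.
by move=> i _; ring.
Qed.

(** * Moments of signed sums on the discrete cube *)

Definition signed_sum {R : realType} {n : nat} (x : 'I_n -> R)
    (s : {ffun 'I_n -> bool}) : R :=
  \sum_i x i * (-1) ^+ s i.

(** Pairing each sign vector with the one that differs from it at [i] turns the
    sum into terms [phi y - phi z], where [y - z = 2 x_i >= 0].  This is where
    the positivity of the coefficients [e^(t_i)] enters. *)
Lemma sign_correlation_ge0 {R : realType} {n : nat} {x : 'I_n -> R}
    {phi : R -> R} {i : 'I_n} : 0 <= x i -> {homo phi : y z / y <= z} ->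
  0 <= \sum_(s : {ffun 'I_n -> bool}) (-1) ^+ s i * phi (signed_sum x s).
Proof.
move=> xi0 phi_homo.
pose flip (s : {ffun 'I_n -> bool}) := [ffun j => s j (+) (j == i)].
have flipK : involutive flip.
  by move=> s; apply/ffunP => j; rewrite !ffunE addbK.
have sum_flip s : signed_sum x (flip s) =
    signed_sum x s - 2 * (x i * (-1) ^+ s i).
  rewrite /signed_sum (bigD1 i)//= [in RHS](bigD1 i)//= ffunE eqxx addbT signrN.
  rewrite (eq_bigr (fun j => x j * (-1) ^+ s j)); first by ring.
  by move=> j /negbTE ji; rewrite ffunE ji addbF.
(* Twice the sum is the sum plus its reindexing along the flip. *)
rewrite -(pmulr_rge0 _ (ltr0Sn R 1)) mulr_natl mulr2n.
rewrite [X in X + _](reindex_inj (inv_inj flipK)) -big_split/=.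
apply: sumr_ge0 => s _; rewrite sum_flip ffunE eqxx addbT.
case: (s i); rewrite /= ?expr0 ?expr1.
- by rewrite mul1r mulN1r subr_ge0 phi_homo//; lra.
- by rewrite mul1r mulN1r addrC subr_ge0 phi_homo//; lra.
Qed.

Lemma sign_moment_gt0 {R : realType} {n : nat} {x : 'I_n -> R} (p : R) :
  (0 < n)%N -> (forall i, 0 < x i) ->
  0 < \sum_s `|signed_sum x s| `^ p.
Proof.
move=> n0 x0; rewrite (bigD1 [ffun=> false])//= ltr_pwDl//.
  rewrite powR_gt0// normr_gt0 gt_eqF// /signed_sum.
  rewrite (bigD1 (Ordinal n0))//= ltr_pwDl// ?ffunE ?mulr1//.
  by apply: sumr_ge0 => i _; rewrite ffunE mulr1 ltW.
by apply: sumr_ge0 => s _; rewrite powR_ge0.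
Qed.

(** The affine minorant: its gradient is [p] times the probability weights
    [x_i c_i / F], which express how much the i-th term contributes to the pairing
    of the signed sum with its dual vector. *)
Lemma ln_sign_moment_tangent {R : realType} {n : nat} {p : R} (u : 'I_n -> R) :
  (0 < n)%N -> 1 <= p ->
  exists g : 'I_n -> R, forall t : 'I_n -> R,
    ln (\sum_s `|signed_sum (expR \o u) s| `^ p) + \sum_i g i * (t i - u i) <=
    ln (\sum_s `|signed_sum (expR \o t) s| `^ p).
Proof.
move=> n0 p1; have p0 : 0 < p by lra.
pose x := expR \o u; pose F := \sum_s `|signed_sum x s| `^ p.
pose c i := \sum_(s : {ffun 'I_n -> bool})
  (-1) ^+ s i * signed_powR (p - 1) (signed_sum x s).
have F0 : 0 < F by apply: sign_moment_gt0 => // i; rewrite expR_gt0.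
have corrE a : \sum_s signed_sum a s * signed_powR (p - 1) (signed_sum x s) =
    \sum_i a i * c i.
  under eq_bigr do rewrite mulr_suml.
  rewrite exchange_big/=; apply: eq_bigr => i _; rewrite mulr_sumr.
  by apply: eq_bigr => s _; rewrite -mulrA.
pose w i := x i * c i / F.
have w0 i : 0 <= w i.
  rewrite divr_ge0 ?(ltW F0)// mulr_ge0 ?expR_ge0//.
  rewrite sign_correlation_ge0 ?expR_ge0//.
  by apply: signed_powR_nondecreasing; lra.
have w1 : \sum_i w i = 1.
  rewrite -mulr_suml -corrE (eq_bigr (fun s => `|signed_sum x s| `^ p)).
    by rewrite divff// gt_eqF.
  by move=> s _; rewrite mulr_signed_powR.
exists (fun i => p * w i) => t.
set m := \sum_i w i * (t i - u i).
have -> : \sum_i p * w i * (t i - u i) = p * m.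
  by rewrite mulr_sumr; apply: eq_bigr => i _; rewrite mulrA.
have mF : expR m * F <= \sum_i expR (t i) * c i.
  rewrite -ler_pdivlMr// mulr_suml.
  have := weighted_expR_ge (fun i => t i - u i) w0 w1.
  rewrite -/m => /le_trans; apply; apply: ler_sum => i _.
  have xE : expR (t i) = x i * expR (t i - u i) by rewrite -expRD subrKC.
  by rewrite xE /w mulrAC (mulrAC (x i)).
rewrite -corrE in mF.
have FG := moment_ge_of_correlation p1 (expR_ge0 m) mF.
have eF0 : 0 < expR m `^ p * F by rewrite mulr_gt0 ?F0 ?powR_gt0 ?expR_gt0.
have lnF : ln (expR m `^ p * F) = ln F + p * m.
  by rewrite lnM ?posrE ?F0 ?powR_gt0 ?expR_gt0 // ln_powR expRK addrC.
rewrite -[leLHS]lnF ler_ln ?posrE.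
- exact: FG.
- exact: eF0.
- exact: lt_le_trans eF0 FG.
Qed.

(** Average the minorants at the intermediate point: their linear parts cancel. *)
Lemma convex_function_of_tangents {R : realType} {n : nat}
    (f : convex_lmodType 'rV[R]_n -> R) :
  (forall u : 'rV[R]_n, exists g : 'I_n -> R, forall t : 'rV[R]_n,
    f u + \sum_i g i * (t ord0 i - u ord0 i) <= f t) ->
  convex_function [set: convex_lmodType 'rV[R]_n] f.
Proof.
move=> tangent k a b _ _.
pose u : 'rV[R]_n := k%:num *: (a : 'rV[R]_n) + (1 - k%:num) *: (b : 'rV[R]_n).
have [g fg] := tangent u.
have k0 : 0 <= k%:num by [].
have k1 : 0 <= 1 - k%:num by rewrite subr_ge0.
rewrite convRE /unstable.onem.
apply: le_trans (lerD (ler_wpM2l k0 (fg a)) (ler_wpM2l k1 (fg b))).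
rewrite -[conv _ _ _]/u le_eqVlt; apply/orP; left; apply/eqP.
rewrite !mulrDr addrACA -mulrDl subrKC mul1r !mulr_sumr -big_split/=.
rewrite big1 ?addr0//.
by move=> i _; rewrite !mxE; ring.
Qed.

(** * Reduction of the expectation to the cube *)

Section cells.
Context {R : realType} {d : measure_display} {T : measurableType d}.
Context {P : probability T R} {eps : nat -> {RV P >-> R}}.
Context (eps_rademacher : forall k, rademacher (eps k)).
Context (eps_independent : independent_RVs eps).
Context {n : nat}.
Implicit Type s : {ffun 'I_n -> bool}.

Definition sign_cell s : set T :=
  [set w | forall i : 'I_n, eps i w = (-1) ^+ s i].

(* Independence speaks of events indexed by [nat]; indices from [n] on are left
   unconstrained. *)
Let A s (k : nat) : set R :=
  if insub k is Some i then [set (-1) ^+ s (i : 'I_n)] else setT.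

Lemma sign_cellE s : sign_cell s =
  \bigcap_(k in [set` seq_fset tt (iota 0 n)]) (eps k @^-1` A s k).
Proof.
apply/seteqP; split=> [w sw k _|w sw i].
  by rewrite /A /=; case: insubP => // i _ <-; exact: sw.
have := sw i; rewrite /A/= valK; apply.
by rewrite /= (seq_fsetE tt (iota 0 n)) mem_iota ltn_ord.
Qed.

Let mA s k : measurable (A s k).
Proof. by rewrite /A; case: insubP => [i _ _|_]//; exact: measurable_set1. Qed.

Lemma measurable_sign_cell s : measurable (sign_cell s).
Proof.
rewrite sign_cellE; apply: bigcap_measurableType => k _.
by rewrite -[_ @^-1` _]setTI; apply: measurable_funPT.
Qed.

Lemma probability_sign_cell s : P (sign_cell s) = (2^-1 ^+ n)%:E.
Proof.
rewrite sign_cellE eps_independent; last exact: mA.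
rewrite (perm_big _ (seq_fset_perm tt (iota 0 n))) undup_id ?iota_uniq//.
rewrite (_ : iota 0 n = index_iota 0 n) ?big_mkord; last first.
  by rewrite /index_iota subn0.
rewrite (eq_bigr (fun=> (2^-1)%:E)); last first.
  move=> i _; rewrite /A valK; have [h1 h2] := eps_rademacher i.
  by case: (s i).
by rewrite prodEFin prodr_const card_ord.
Qed.

Lemma trivIset_sign_cell : trivIset setT sign_cell.
Proof.
move=> s s' _ _ [w [sw s'w]]; apply/ffunP => i.
by apply: (@signr_inj R); rewrite -(sw i) -(s'w i).
Qed.

(** The [2^n] cells are disjoint and each has probability [2^-n], so they carry
    the whole mass and any event outside them is negligible; on a cell the
    integrand is constant. *)
Lemma expectation_sign_average {g : T -> R} (G : {ffun 'I_n -> bool} -> R) :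
  measurable_fun setT g -> (forall w, 0 <= g w) ->
  (forall s w, sign_cell s w -> g w = G s) ->
  'E_P[g]%E = (2^-1 ^+ n * \sum_s G s)%:E.
Proof.
move=> mg g0 gG.
pose U := \big[setU/set0]_(s in {ffun 'I_n -> bool}) sign_cell s.
have mU : measurable U.
  by apply: bigsetU_measurable => s _; exact: measurable_sign_cell.
have integral_cells (f : T -> \bar R) :
    measurable_fun U f -> (forall w, U w -> (0 <= f w)%E) ->
    (\int[P]_(w in U) f w = \sum_s \int[P]_(w in sign_cell s) f w)%E.
  move=> mf f0; rewrite ge0_integral_bigsetU ?index_enum_uniq//.
  - exact: measurable_sign_cell.
  - exact: sub_trivIset trivIset_sign_cell.
have PU : P U = 1%E.
  rewrite -[LHS]mul1e -integral_cst// integral_cells//.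
  rewrite (eq_bigr (fun=> (2^-1 ^+ n)%:E)) => [|s _].
    rewrite sumEFin sumr_const card_ffun card_bool card_ord.
    by rewrite -(mulr_natl (_ ^+ n)) natrX -exprMn divff// expr1n.
  rewrite integral_cst; last exact: measurable_sign_cell.
  rewrite mul1e; exact: probability_sign_cell.
have PUC : P (~` U) = 0%E by rewrite probability_setC// PU subee.
rewrite unlock (@ge0_negligible_integral _ _ _ _ _ (~` U)) => //; last first.
- by move=> w _; rewrite lee_fin.
- exact/measurable_EFinP.
- exact: measurableC.
rewrite setDE setCK setTI integral_cells; last 2 first.
- by apply: measurable_funTS; exact/measurable_EFinP.
- by move=> w _; rewrite lee_fin.
rewrite mulr_sumr -sumEFin; apply: eq_bigr => s _.
rewrite (eq_integral (cst (G s)%:E)); last by move=> w /[!inE] /gG ->.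
rewrite integral_cst; last exact: measurable_sign_cell.
by rewrite [X in (_ * X)%E](probability_sign_cell s) -EFinM mulrC.
Qed.

End cells.

Theorem theorem3 (R : realType) (d : measure_display) (T : measurableType d)
    (P : probability T R) (eps : nat -> {RV P >-> R})
    (eps_rademacher : forall k, rademacher (eps k))
    (eps_independent : independent_RVs eps)
    (n : nat) (n_ge1 : (1 <= n)%N) (p : R) (p_ge1 : 1 <= p) :
  convex_function [set: convex_lmodType 'rV[R]_n] (Phi eps p).
Proof.
have PhiE (t : 'rV[R]_n) : Phi eps p t = ln (2^-1 ^+ n) +
    ln (\sum_s `|signed_sum (expR \o t ord0) s| `^ p).
  rewrite /Phi (expectation_sign_average eps_rademacher eps_independent
    (fun s => `|signed_sum (expR \o t ord0) s| `^ p)).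
  - rewrite lnM ?posrE ?exprn_gt0 ?invr_gt0//.
    by apply: sign_moment_gt0 => // i; exact: expR_gt0.
  - apply: (measurableT_comp (measurable_powR p)).
    apply: measurableT_comp => //; apply: measurable_sum => i.
    by apply: measurable_funM => //.
  - by move=> w; rewrite powR_ge0.
  - by move=> s w sw; congr (`|_| `^ p); apply: eq_bigr => i _; rewrite sw.
apply: convex_function_of_tangents => u.
have [g tangent] := ln_sign_moment_tangent (u ord0) n_ge1 p_ge1.
by exists g => t; rewrite !PhiE -addrA lerD2l.
Qed.
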